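(* Let $M\ge1$ be an integer, $P,\sigma^2,\beta_1,\beta_2>0$, $\alpha_{\rm NCR}\ge0$, $\varphi_1\in\mathbb{R}$, let $\mathbf{a}_{2,1}\in\mathbb{C}^M$ have unit-modulus entries, and let $\mathbf{h}_3\in\mathbb{C}^M$. Let $\mathbf{g}=\alpha_{\rm NCR}\sqrt{\beta_1\beta_2}\,\mathbf{a}_{2,1}e^{\mathsf{j}\varphi_1}+\mathbf{h}_3$ and define the NCR-assisted SNR with optimal (MMSE) combining by $$\mathrm{SNR}_{\rm NCR}=P\,\mathbf{g}^{H}\left(\alpha_{\rm NCR}^2\beta_2\sigma^2\mathbf{a}_{2,1}\mathbf{a}_{2,1}^{H}+\sigma^2\mathbf{I}_M\right)^{-1}\mathbf{g}.$$ Then $$\mathrm{SNR}_{\rm NCR}=\frac{P\alpha_{\rm NCR}^2M\beta_1\beta_2-P\alpha_{\rm NCR}^2\beta_2|\mathbf{h}_3^{H}\mathbf{a}_{2,1}|^2+2P\alpha_{\rm NCR}\sqrt{\beta_1\beta_2}\,\Re\left(\mathbf{h}_3^{H}\mathbf{a}_{2,1}e^{\mathsf{j}\varphi_1}\right)}{\sigma^2\left(1+\alpha_{\rm NCR}^2\beta_2M\right)}+\frac{P\|\mathbf{h}_3\|^2}{\sigma^2}.$$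
   Context: $\mathsf{j}$ is the imaginary unit, $(\cdot)^H$ is the conjugate transpose, $\Re$ is the real part, and $\|\cdot\|$ is the Euclidean norm. The setting is an uplink assisted by a network-controlled repeater (NCR) of amplification gain $\alpha_{\rm NCR}$ with a direct user–base-station channel $\mathbf{h}_3$. *)

(* Defs.v *)
From HB Require Import structures.
From mathcomp Require Import all_boot all_order all_algebra.
From mathcomp Require Import complex.
From mathcomp Require Import reals trigo.

Set Implicit Arguments.
Unset Strict Implicit.
Unset Printing Implicit Defensive.

Import Order.TTheory GRing.Theory Num.Theory.
Local Open Scope ring_scope.
Local Open Scope complex_scope.
Local Open Scope sesquilinear_scope.

(* e^{j x} for real x, by Euler's formula *)
Definition expj (R : realType) (x : R) : R[i] := cos x +i* sin x.

(* [Normc.normc] is the modulus with values in [R], while [`|z|] is the same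
   real number embedded in [R[i]]. *)
Definition enorm (R : realType) (M : nat) (v : 'cV[R[i]]_M) : R :=
  Num.sqrt (\sum_(i < M) Normc.normc (v i 0) ^+ 2).

Definition ncr_channel (R : realType) (M : nat) (alpha beta1 beta2 phi1 : R)
    (a21 h3 : 'cV[R[i]]_M) : 'cV[R[i]]_M :=
  ((alpha * Num.sqrt (beta1 * beta2))%:C * expj phi1) *: a21 + h3.

Definition ncr_noise_cov (R : realType) (M : nat) (alpha beta2 sigma2 : R)
    (a21 : 'cV[R[i]]_M) : 'M[R[i]]_M :=
  (alpha ^+ 2 * beta2 * sigma2)%:C *: (a21 *m a21 ^t*) + sigma2%:C *: 1%:M.

(* The noise covariance is Hermitian positive definite for [0 < sigma2] and
   [0 <= beta2], so [invmx] is a genuine inverse there. *)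
Definition ncr_snr (R : realType) (M : nat)
    (P alpha beta1 beta2 phi1 sigma2 : R) (a21 h3 : 'cV[R[i]]_M) : R[i] :=
  let g := ncr_channel alpha beta1 beta2 phi1 a21 h3 in
  P%:C * (g ^t* *m invmx (ncr_noise_cov alpha beta2 sigma2 a21) *m g) 0 0.

(* Main.v *)
(** The noise covariance is a rank-one update of a multiple of the identity, so
    the Sherman-Morrison formula inverts it; with [k = alpha^2 beta2] the SNR is
    [P / sigma2 * (|g|^2 - k / (1 + k M) * |a^H g|^2)].  Substituting
    [g = c a + h] and [a^H a = M], the terms in [M^2] cancel and only the
    stated combination of [|c|^2], [h^H a] and [|h|^2] survives. *)
Require Import Defs.
From HB Require Import structures.
From mathcomp Require Import all_boot all_order all_algebra.
From mathcomp Require Import complex.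
From mathcomp Require Import reals trigo.
From mathcomp Require Import ring.

Import Order.TTheory GRing.Theory Num.Theory.
Local Open Scope ring_scope.
Local Open Scope complex_scope.
Local Open Scope sesquilinear_scope.

(** Since [(u *m v) *m (u *m v)] is the scalar [(v *m u) 0 0] times [u *m v], the product with the
    claimed inverse stays in the span of [1%:M] and [u *m v], where it reduces to scalar algebra.
    For square matrices a right inverse is enough. *)
Lemma invmx_rank1_update (F : fieldType) (n : nat) (s k : F)
    (u : 'cV[F]_n) (v : 'rV[F]_n) :
  s != 0 -> 1 + k * (v *m u) 0 0 != 0 ->
  invmx ((k * s) *: (u *m v) + s *: 1%:M) =
  s^-1 *: (1%:M - (k / (1 + k * (v *m u) 0 0)) *: (u *m v)).
Proof.
move=> s0; set d := (v *m u) 0 0; set W := u *m v => d0.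
set A := (X in invmx X); set B := RHS.
have WW : W *m W = d *: W.
  by rewrite -mulmxA (mulmxA v) [v *m u]mx11_scalar mul_scalar_mx -scalemxAr.
have AB1 : A *m B = 1%:M.
  rewrite /A /B -scalemxAr mulmxDl !mulmxBr -!scalemxAl !mulmx1 -!scalemxAr.
  rewrite mul1mx WW; apply/matrixP => i j.
  (* Forgetting the bodies of [d] and [W] keeps [mxE] from expanding them into sums, so [field] sees
     atoms. *)
  move: d W d0 {A B WW} => d W d0; rewrite !mxE.
  by field; rewrite s0 d0.
have [uA _] := mulmx1_unit AB1.
by rewrite -[LHS]mulmx1 -AB1 mulmxA mulVmx // mul1mx.
Qed.

Lemma dotmxC (C : numClosedFieldType) (n : nat) (x y : 'cV[C]_n) :
  (y ^t* *m x) 0 0 = ((x ^t* *m y) 0 0)^*%R.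
Proof.
rewrite !mxE rmorph_sum; apply: eq_bigr => i _.
by rewrite !mxE rmorphM /= conjCK mulrC.
Qed.

(** Over the common denominator [1 + k * d], the part of [|g^H a|^2] carrying a factor [d] cancels
    against [k * d] times the [c]-dependent part of [|g|^2]; only [- k * |z|^2] is left of the
    correction. *)
Lemma quadform_invmx_rank1_update (C : numClosedFieldType) (n : nat) (s k c : C)
    (a h : 'cV[C]_n) (d := (a ^t* *m a) 0 0) (z := (h ^t* *m a) 0 0) :
  s != 0 -> 1 + k * d != 0 ->
  ((c *: a + h) ^t* *m invmx ((k * s) *: (a *m a ^t*) + s *: 1%:M)
     *m (c *: a + h)) 0 0 =
  (`|c| ^+ 2 * d - k * `|z| ^+ 2 + (z * c + (z * c)^*%R)) / (s * (1 + k * d))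
  + (h ^t* *m h) 0 0 / s.
Proof.
move=> s0 d0; rewrite invmx_rank1_update //.
(* Entry rules restricted to 1x1 matrices leave the inner products folded, where [mxE] would open
   them. *)
have addE (X Y : 'M[C]_1) : (X + Y) 0 0 = X 0 0 + Y 0 0 by rewrite mxE.
have oppE (X : 'M[C]_1) : (- X) 0 0 = - X 0 0 by rewrite mxE.
have scaleE t (X : 'M[C]_1) : (t *: X) 0 0 = t * X 0 0 by rewrite mxE.
set g := c *: a + h.
have ga : (g ^t* *m a) 0 0 = c^*%R * d + z.
  by rewrite /g linearD linearZ /= map_mxD map_mxZ mulmxDl -scalemxAl addE scaleE.
have gg : (g ^t* *m g) 0 0 =
    `|c| ^+ 2 * d + (z * c + (z * c)^*%R) + (h ^t* *m h) 0 0.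
  rewrite {2}/g mulmxDr -scalemxAr addE scaleE ga (dotmxC _ _ h g) /g.
  rewrite mulmxDr -scalemxAr addE scaleE -/z rmorphD /= -dotmxC normCK rmorphM /=.
  ring.
have ag : (a ^t* *m g) 0 0 = (c^*%R * d + z)^*%R by rewrite dotmxC ga.
have dR : d^*%R = d by rewrite -dotmxC.
rewrite -scalemxAr -scalemxAl mulmxBr mulmxBl mulmx1 -scalemxAr -scalemxAl.
(* Reassociation splits the rank-one term into the scalars [g^H a] and [a^H g], conjugates of each
   other. *)
rewrite (mulmxA _ a) -(mulmxA (_ *m a)) [g ^t* *m a]mx11_scalar.
rewrite mul_scalar_mx ga scaleE addE oppE !scaleE.
rewrite ag gg !(rmorphD, rmorphM) /= conjCK dR !normCK.
by rewrite -/d; field; rewrite s0 d0.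
Qed.

Lemma sum_sqr_normc (R : realType) (n : nat) (h : 'cV[R[i]]_n) :
  (h ^t* *m h) 0 0 = (enorm h ^+ 2)%:C.
Proof.
rewrite /enorm sqr_sqrtr; last by apply: sumr_ge0 => i _; apply: sqr_ge0.
rewrite rmorph_sum mxE; apply: eq_bigr => i _.
by rewrite !mxE mulrC -normCK rmorphXn.
Qed.

Lemma addc_conj (R : rcfType) (w : R[i]) :
  w + Num.conj w = (2 * complex.Re w)%:C.
Proof.
case: w => x y; apply/eqP.
by rewrite eq_complex /= subrr mulr_natl mulr2n !eqxx.
Qed.

Lemma normr_expj (R : realType) (x : R) : `|expj x| = 1.
Proof. by rewrite /expj normc_def /= cos2Dsin2 sqrtr1. Qed.

Lemma dotmx_unimodular (C : numClosedFieldType) (n : nat) (a : 'cV[C]_n) :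
  (forall i, `|a i 0| = 1) -> (a ^t* *m a) 0 0 = n%:R.
Proof.
move=> a1; rewrite mxE (eq_bigr (fun=> 1)) ?sumr_const ?card_ord // => i _.
by rewrite !mxE mulrC -normCK a1 expr1n.
Qed.

Theorem mainTheorem10 (R : realType) (M : nat)
    (P sigma2 beta1 beta2 alpha phi1 : R) (a21 h3 : 'cV[R[i]]_M)
    (hM : (1 <= M)%N) (hP : 0 < P) (hsigma2 : 0 < sigma2)
    (hbeta1 : 0 < beta1) (hbeta2 : 0 < beta2) (halpha : 0 <= alpha)
    (ha21 : forall i : 'I_M, `|a21 i 0| = 1) :
  ncr_snr P alpha beta1 beta2 phi1 sigma2 a21 h3 =
  ((P * alpha ^+ 2 * M%:R * beta1 * beta2
    - P * alpha ^+ 2 * beta2 * Normc.normc ((h3 ^t* *m a21) 0 0) ^+ 2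
    + 2 * P * alpha * Num.sqrt (beta1 * beta2)
      * complex.Re ((h3 ^t* *m a21) 0 0 * expj phi1))
   / (sigma2 * (1 + alpha ^+ 2 * beta2 * M%:R))
   + P * enorm h3 ^+ 2 / sigma2)%:C.
Proof.
have s0 : sigma2 != 0 by rewrite gt_eqF.
have d0 : 1 + alpha ^+ 2 * beta2 * M%:R != 0.
  by rewrite gt_eqF // ltr_pwDl // !mulr_ge0 ?sqr_ge0 ?ler0n // ltW.
have d0C : 1 + (alpha ^+ 2 * beta2)%:C * (a21 ^t* *m a21) 0 0 != 0.
  rewrite dotmx_unimodular // -(rmorph_nat (real_complex R)).
  by rewrite -rmorphM -(rmorph1 (real_complex R)) -rmorphD fmorph_eq0.
(* Splitting the embedded coefficient exposes the shape [k * s] with [k = alpha ^+ 2 * beta2] and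
   [s = sigma2]. *)
rewrite /ncr_snr /ncr_channel /ncr_noise_cov [in X in X *: (a21 *m _)]rmorphM.
rewrite quadform_invmx_rank1_update ?fmorph_eq0 // dotmx_unimodular // sum_sqr_normc.
set z := (h3 ^t* *m a21) 0 0.
set c := alpha * Num.sqrt (beta1 * beta2).
have cc : `|c%:C * expj phi1| ^+ 2 = (alpha ^+ 2 * (beta1 * beta2))%:C.
  rewrite normrM normr_expj mulr1 normc_def /= expr0n addr0 sqrtr_sqr.
  rewrite -rmorphXn /= real_normK ?num_real //.
  by rewrite /c exprMn sqr_sqrtr // mulr_ge0 ?ltW.
have zz : `|z| ^+ 2 = (Normc.normc z ^+ 2)%:C by rewrite rmorphXn.
rewrite cc zz (mulrCA z) addc_conj.
have -> : complex.Re (c%:C * (z * expj phi1)) = c * complex.Re (z * expj phi1).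
  by case: (z * _) => x y /=; rewrite mul0r subr0.
(* Every remaining scalar is the image of a real, so both sides gather under one embedding and the
   identity descends to [R]. *)
rewrite -(rmorph_nat (real_complex R)) -(rmorph1 (real_complex R)).
rewrite -!(rmorphM, rmorphD, rmorphB) -!fmorphV -!(rmorphM, rmorphD) /=.
congr (_ %:C); rewrite /c.
by field; rewrite s0 d0.
Qed.
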